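(* Let $n\ge 1$, let $\rho=(n,n-1,\ldots,1)$ be the staircase partition, and let $\mu\subseteq\rho$ be any subpartition. Then $$g_{\rho/\mu}=g_{\rho/\mu^T},$$ where $g_{\lambda/\mu}$ denotes the skew dual stable Grothendieck polynomial and $\mu^T$ is the conjugate partition of $\mu$.
   Context: For partitions, $\mu\subseteq\lambda$ means $\mu_i\le\lambda_i$ for all $i$; the skew Young diagram $Y(\lambda/\mu)$ consists of the cells of the (left-aligned, English-convention) Young diagram of $\lambda$ not in that of $\mu$. The conjugate $\mu^T$ is obtained by reflecting the Young diagram over the main diagonal. A reverse plane partition of shape $\lambda/\mu$ is a filling of the cells of $Y(\lambda/\mu)$ with positive integers, weakly increasing along each row (left to right) and down each column. For such a filling $P$, let $x^P=\prod_{i\ge1}x_i^{w_i}$, where $w_i$ is the number of columns of $P$ containing the number $i$ (at least once). The skew dual stable Grothendieck polynomial is $g_{\lambda/\mu}=\sum_P x^P$, a formal power series in $x_1,x_2,\ldots$, summed over all reverse plane partitions $P$ of shape $\lambda/\mu$. *)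

(* Defs.v *)
From mathcomp Require Import all_boot all_order all_algebra.
From mathcomp Require Import finmap.
From mathcomp Require Import all_classical.

Set Implicit Arguments.
Unset Strict Implicit.
Unset Printing Implicit Defensive.

Import GRing.Theory.
Local Open Scope ring_scope.

(* A partition is the sequence of its nonzero parts; [nth 0 la i] is the part
   indexed by [i], which is 0 beyond the length of [la]. Rows and columns are
   numbered from 0. *)
Definition is_part (la : seq nat) : bool := sorted geq la && (0%N \notin la).

Definition part_sub (mu la : seq nat) : Prop :=
  forall i, (nth 0 mu i <= nth 0 la i)%N.

Definition diagram (la : seq nat) (c : nat * nat) : bool :=
  (c.2 < nth 0 la c.1)%N.

Definition skew_diagram (la mu : seq nat) (c : nat * nat) : bool :=
  diagram la c && ~~ diagram mu c.

(* The parts of the conjugate are the column lengths; that it is a partition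
   whose diagram is the reflected one is proved in [conj_part_is_part] and
   [diagram_conj_part]. *)
Definition conj_part (mu : seq nat) : seq nat :=
  mkseq (fun j => count (fun r => j < r)%N mu) (head 0%N mu).

Definition staircase (n : nat) : seq nat := mkseq (fun i => n - i)%N n.

(* When [la] is a partition, its diagram lies in a
   [size la] x [head 0 la] rectangle. *)
Definition cell (la mu : seq nat) : finType :=
  {c : 'I_(size la) * 'I_(head 0%N la)
     | skew_diagram la mu (nat_of_ord c.1, nat_of_ord c.2)}.

Definition crow la mu (c : cell la mu) : 'I_(size la) := (val c).1.
Definition ccol la mu (c : cell la mu) : 'I_(head 0%N la) := (val c).2.

Definition filling (la mu : seq nat) := {ffun cell la mu -> nat}.

Definition is_rpp la mu (P : filling la mu) : Prop :=
  [/\ forall c, (0 < P c)%N,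
      forall c d, crow c = crow d -> (ccol c <= ccol d)%N -> (P c <= P d)%N &
      forall c d, ccol c = ccol d -> (crow c <= crow d)%N -> (P c <= P d)%N].

Definition weight la mu (P : filling la mu) (i : nat) : nat :=
  #|[set j : 'I_(head 0%N la) | [exists c, (ccol c == j) && (P c == i)]]|.

(* A monomial is its finitely supported family of exponents, [m i] being the
   exponent of x_i. A power series is its family of coefficients. The index 0
   is allowed for convenience, but since the entries of a reverse plane
   partition are positive, x_0 never occurs in the series below. *)
Definition monomial := {fsfun nat -> nat with 0%N}.
Definition power_series := monomial -> int.

Definition mono (m : monomial) : power_series := fun m' => (m == m')%:R.

(* The monomial x^P; see [rpp_monoE]. *)
Definition rpp_mono la mu (P : filling la mu) : monomial :=
  [fsfun i in [fset i | i in codom P]%fset => weight P i].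

(* The sum of the series x^P over all reverse plane partitions, taken
   coefficientwise. [\sum_(i \in A)] is junk unless the summand has finite
   support on [A], which is shown in [dual_groth_finite]. *)
Definition dual_groth (la mu : seq nat) : power_series := fun m =>
  (\sum_(P \in [set P : filling la mu | is_rpp P]%classic) mono (rpp_mono P) m).

Lemma conj_part_is_part mu : is_part (conj_part mu).
Proof.
apply/andP; split.
  rewrite /conj_part /mkseq; apply: (homo_sorted (e := leq)).
    by move=> i j ij; apply: sub_count => r /=; apply: leq_ltn_trans.
  exact: iota_sorted.
apply/negP => /mapP[j]; rewrite mem_iota /= add0n => jlt.
by case: mu jlt => //= a mu ->.
Qed.

Lemma diagram_conj_part mu i j : is_part mu ->
  diagram (conj_part mu) (i, j) = diagram mu (j, i).
Proof.
case/andP=> smu _; rewrite /diagram /=.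
have key : (j < count (fun r => i < r)%N mu)%N = (i < nth 0 mu j)%N.
  elim: mu smu j => [|a mu IH] smu j /=; first by rewrite nth_nil.
  have smu' : sorted geq mu by apply: path_sorted smu.
  have amu : all (geq a) mu by apply: order_path_min smu => x y z /= ? /leq_trans ->.
  case: (ltnP i a) => ia; first by case: j => [|j] //=; rewrite add1n ltnS IH.
  have c0 : count (fun r => i < r)%N mu = 0%N.
    apply/eqP; rewrite -leqn0 leqNgt -has_count; apply/negP => /hasP[r rm ir].
    by have /= := allP amu r rm; rewrite leqNgt (leq_ltn_trans ia ir).
  rewrite c0 /=; case: j => [|j] /=; first by rewrite [RHS]ltnNge ia.
  by rewrite -IH // c0.
case: (ltnP i (head 0%N mu)) => ih; first by rewrite nth_mkseq.
rewrite nth_default ?size_mkseq //; symmetry; rewrite ltn0 -key.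
case: mu smu ih key => [|a mu] //= smu ih _.
have amu : all (geq a) mu by apply: order_path_min smu => x y z /= ? /leq_trans ->.
rewrite [(i < a)%N]ltnNge ih /= add0n; apply/negP => jlt.
have /hasP[r rm ir] : has (fun r => i < r)%N mu by rewrite has_count; case: count jlt.
by have /= := allP amu r rm; rewrite leqNgt (leq_ltn_trans ih ir).
Qed.

Lemma rpp_monoE la mu (P : filling la mu) i : rpp_mono P i = weight P i.
Proof.
rewrite fsfun_fun; case: ifP => // /negbT iP; symmetry; apply/eqP.
rewrite cards_eq0; apply/eqP/setP => j; rewrite finset.in_set finset.in_set0; apply/negbTE/negP.
case/fintype.existsP=> c /andP[_ /eqP Pc]; case/negP: iP.
by apply/imfsetP; exists i => //=; rewrite -Pc codom_f.
Qed.

Lemma dual_groth_finite la mu (m : monomial) :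
  finite_set [set P : filling la mu | is_rpp P /\ rpp_mono P = m]%classic.
Proof.
pose s := finsupp m; pose N := (\max_(i <- s) i).+1.
have lt_N (P : filling la mu) : rpp_mono P = m -> forall c, (P c < N)%N.
  move=> Pm c; rewrite ltnS; apply: (leq_bigmax_seq (F := id)) => //.
  rewrite mem_finsupp -Pm rpp_monoE -lt0n card_gt0; apply/set0Pn.
  by exists (ccol c); rewrite finset.in_set; apply/fintype.existsP; exists c; rewrite !eqxx.
pose f (Q : {ffun cell la mu -> 'I_N}) : filling la mu :=
  [ffun c => nat_of_ord (Q c)].
apply: (@sub_finite_set _ _ (f @` setT)%classic); last first.
  by apply: finite_image; apply: finite_finset.
move=> P [_ Pm] /=; exists [ffun c => Ordinal (lt_N P Pm c)] => //.
by apply/ffunP => c; rewrite !ffunE.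
Qed.

(* Main.v *)
(* For ideals (partitions in the box) let T(x) be the operator
   v |-> (mu |-> sum over kap containing mu of x^c(kap/mu) v(kap)), c being the
   number of nonempty columns, and T'(x) its analogue for the number r of
   nonempty rows. Removing the entries of a reverse plane partition in
   increasing order writes g_{la/mu}(x_1, x_2, ...) as T(x_1) T(x_2) ... delta_la evaluated at
   mu, and the T' give g for the conjugate shapes.
   - T(x) and T'(y) commute. Between fixed boundary paths both sides are Tutte
     polynomials of one lattice path matroid, computed by deletion and
     contraction from the two opposite ends.
   - T'(1 - y) T(y) is the zeta operator T(1) = T'(1), because the deletion and
     contraction recursion then has weights adding up to 1. As T'(1 - y) is
     unipotent, T(x) and T(y) commute as well.
   - In a staircase every nonempty row or column of rho/mu contains exactly one
     antidiagonal cell outside mu, so c(rho/mu) = r(rho/mu) and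
     T(x) delta_rho = T'(x) delta_rho.
   Hence T(x_1) ... T(x_k) delta_rho = T'(x_1) ... T'(x_k) delta_rho. *)

Require Import Defs.
From mathcomp Require Import all_boot all_order all_algebra finmap.
From mathcomp Require Import finmap.
From mathcomp Require Import zify ring boolp.

Set Implicit Arguments.
Unset Strict Implicit.
Unset Printing Implicit Defensive.

Import GRing.Theory.
Local Open Scope ring_scope.

(** * The boundary path polynomial of two nested ideals *)

Section PathPolynomial.
Variables (A B : finType) (R : comNzRingType).
Implicit Types (la mu kap : {set A * B}) (rs : seq A) (cs : seq B).

(* Rows are listed from bottom to top and columns from left to right: the
   recursion follows the boundary path of an ideal between [mu] and [la] from
   its bottom-left end, a step along [mu] or [la] being forced. *)
Fixpoint path_poly (x y : R) la mu rs : seq B -> R :=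
  if rs is r :: rs' then
    fix go cs := if cs is c :: cs' then
      if (r, c) \in mu then go cs'
      else if (r, c) \notin la then path_poly x y la mu rs' cs
      else x * go cs' + y * path_poly x y la mu rs' cs
    else 1
  else fun=> 1.

Lemma path_poly_nilr x y la mu rs : path_poly x y la mu rs [::] = 1.
Proof. by case: rs. Qed.

Lemma path_poly_cons x y la mu r rs c cs :
  path_poly x y la mu (r :: rs) (c :: cs) =
    if (r, c) \in mu then path_poly x y la mu (r :: rs) cs
    else if (r, c) \notin la then path_poly x y la mu rs (c :: cs)
    else x * path_poly x y la mu (r :: rs) cs
         + y * path_poly x y la mu rs (c :: cs).
Proof. by []. Qed.

(** A forced step copies a value equal to 1, and a free step averages two such values with the
    weights [z] and [1 - z]. *)
Lemma path_poly_total z la mu rs cs : path_poly z (1 - z) la mu rs cs = 1.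
Proof.
elim: rs cs => [|r rs IHr] //; elim=> [|c cs IHc] //.
by rewrite path_poly_cons IHc IHr; case: ifP => // _; case: ifP => // _; ring.
Qed.

(** The ideal condition read along the lists, from the bottom row and the left column; in this form
    it passes to sublists, as the inductions require. *)
Definition row_closed rs cs (S : {set A * B}) :=
  all (fun r => pairwise (fun c c' => ((r, c') \in S) ==> ((r, c) \in S)) cs) rs.
Definition col_closed rs cs (S : {set A * B}) :=
  all (fun c => pairwise (fun r r' => ((r, c) \in S) ==> ((r', c) \in S)) rs) cs.

(* Deletion and contraction at the top-right corner. *)
Lemma path_poly_rcons x y la mu r rs c cs :
  (forall p, p \in mu -> p \in la) ->
  row_closed (rcons rs r) (rcons cs c) la -> row_closed (rcons rs r) (rcons cs c) mu ->
  col_closed (rcons rs r) (rcons cs c) la -> col_closed (rcons rs r) (rcons cs c) mu ->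
  path_poly x y la mu (rcons rs r) (rcons cs c) =
    if (r, c) \in mu then path_poly x y la mu rs (rcons cs c)
    else if (r, c) \notin la then path_poly x y la mu (rcons rs r) cs
    else x * path_poly x y la mu (rcons rs r) cs
         + y * path_poly x y la mu rs (rcons cs c).
Proof.
move=> sub.
have [n] := ubnP (size rs + size cs); elim: n rs cs => // n IH rs cs lt_n rl rm cl cm.
have behead_r S a s t : row_closed (a :: s) t S -> row_closed s t S by case/andP.
have behead_r' S s a t : row_closed s (a :: t) S -> row_closed s t S.
  by apply: sub_all => b /andP[].
have behead_c S a s t : col_closed (a :: s) t S -> col_closed s t S.
  by apply: sub_all => b /andP[].
have behead_c' S s a t : col_closed s (a :: t) S -> col_closed s t S by case/andP.
case: rs cs lt_n rl rm cl cm => [|r0 rs] [|c0 cs]; rewrite ?rcons_cons => lt_n rl rm cl cm.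
- rewrite /=; case: ifP => // _; case: ifP => //.
(* With a single row both corners lie in it, and closedness carries membership in [mu] or [la] from
   [(r, c)] to [(r, c0)]. The case of a single column is similar. *)
- rewrite [rcons [::] r]/= in rl rm cl cm *.
  have E1 := IH [::] cs ltac:(move: lt_n => /=; lia) (behead_r' _ _ _ _ rl) (behead_r' _ _ _ _ rm)
     (behead_c' _ _ _ _ cl) (behead_c' _ _ _ _ cm).
  rewrite !path_poly_cons /= in E1 *.
  have /= := allP rl r (mem_head _ _); rewrite all_rcons => /andP[/andP[/implyP rl0 _] _].
  have /= := allP rm r (mem_head _ _); rewrite all_rcons => /andP[/andP[/implyP rm0 _] _].
  rewrite E1 /=.
  case: (boolP ((r, c) \in mu)) => m1; first by rewrite rm0.
  case: (boolP ((r, c) \in la)) => l1 /=; first by rewrite rl0 //=; case: ifP => // _; ring.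
  by [].
- rewrite [rcons [::] c]/= in rl rm cl cm *.
  have E1 := IH rs [::] ltac:(move: lt_n => /=; lia) (behead_r _ _ _ _ rl) (behead_r _ _ _ _ rm)
     (behead_c _ _ _ _ cl) (behead_c _ _ _ _ cm).
  rewrite !path_poly_cons !path_poly_nilr [rcons [::] c]/= in E1 *.
  rewrite E1.
  have /= := allP cl c (mem_head _ _); rewrite all_rcons => /andP[/andP[/implyP cl0 _] _].
  have /= := allP cm c (mem_head _ _); rewrite all_rcons => /andP[/andP[/implyP cm0 _] _].
  case: (boolP ((r0, c) \in mu)) => m0.
    by rewrite cm0.
  case: (boolP ((r0, c) \in la)) => l0 /=.
    rewrite cl0 //=; case: ifP => // _; ring.
  by [].
(* With at least two rows and two columns, the steps at the bottom-left end and at the top-right end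
   are independent, so the two expansions commute. *)
- have E1 := IH (r0 :: rs) cs ltac:(move: lt_n => /=; lia) (behead_r' _ _ _ _ rl) (behead_r' _ _ _ _ rm)
     (behead_c' _ _ _ _ cl) (behead_c' _ _ _ _ cm).
  have E2 := IH rs (c0 :: cs) ltac:(move: lt_n => /=; lia) (behead_r _ _ _ _ rl) (behead_r _ _ _ _ rm)
     (behead_c _ _ _ _ cl) (behead_c _ _ _ _ cm).
  rewrite !rcons_cons in E1 E2; rewrite !path_poly_cons E1 E2.
  case: ifP => // _; case: ifP => // _; case: ifP => // _; case: ifP => // _; ring.
Qed.

(* Outside the grid [kap] is prescribed by [E], so that deleting a row or a
   column changes the conditions on [kap] and not [kap] itself. *)
Definition admissible la mu rs cs (E kap : {set A * B}) :=
  [&& row_closed rs cs kap, col_closed rs cs kap &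
   [forall p, if (p.1 \in rs) && (p.2 \in cs)
              then ((p \in mu) ==> (p \in kap)) && ((p \in kap) ==> (p \in la))
              else (p \in kap) == (p \in E)]].

Definition cols_in rs cs (S : {set A * B}) :=
  count (fun c => has (fun r => (r, c) \in S) rs) cs.
Definition rows_in rs cs (S : {set A * B}) :=
  count (fun r => has (fun c => (r, c) \in S) cs) rs.

(** An ideal containing the bottom-left cell [(r, c)] contains the whole listed column [c], which
    can then be moved into the prescribed part [E]. *)
Lemma admissible_col la mu r rs c cs E kap : uniq (c :: cs) ->
  (forall i, i \in r :: rs -> (i, c) \in la) ->
  admissible la mu (r :: rs) (c :: cs) E kap && ((r, c) \in kap) =
  admissible la mu (r :: rs) cs (E :|: [set p | (p.2 == c) && (p.1 \in r :: rs)]) kap.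
Proof.
move=> /andP[ncs _] lac; apply/idP/idP.
- case/andP=> /and3P[rk ck /forallP ek] kc.
  have kic i : i \in r :: rs -> (i, c) \in kap.
    rewrite inE => /predU1P[-> //|irs].
    by have /andP[/andP[/allP/(_ i irs)/implyP/(_ kc)]] := ck.
  apply/and3P; split.
  + by move: rk; apply: sub_all => i /andP[].
  + by case/andP: ck.
  apply/forallP => -[i j]; have := ek (i, j); rewrite /= !inE.
  have [->|jc] := eqVneq j c; last by rewrite /= orbF.
  rewrite (negbTE ncs) /= andbF andbT.
  case: ifP => [iR _|_ /eqP ->]; last by rewrite orbF.
  by rewrite kic ?inE // orbT.
- case/and3P=> rk ck /forallP ek.
  have kic i : i \in r :: rs -> (i, c) \in kap.
    move=> iR; have := ek (i, c); rewrite /= (negbTE ncs) andbF => /eqP ->.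
    by rewrite !inE eqxx -in_cons iR orbT.
  rewrite kic ?mem_head // andbT; apply/and3P; split.
  + apply/allP=> i iR /=; rewrite (allP rk) // andbT; apply/allP => j _ /=.
    by rewrite (kic i) ?implybT.
  + apply/andP; split=> //; apply: (@sub_in_pairwise _ (mem (r :: rs)) (fun _ _ => true)).
    * by move=> i j _ jR _ /=; rewrite (kic j) ?implybT.
    * exact/allP.
    * by elim: (r :: rs) => //= a s ->; rewrite andbT; apply/allP.
  apply/forallP => -[i j]; have := ek (i, j); rewrite /= [j \in c :: cs]inE.
  have [->|jc] := eqVneq j c; last by rewrite !inE (negbTE jc) orbF.
  rewrite (negbTE ncs) /= andbF andbT !inE eqxx /=.
  case: ifP => [iR _|_]; last by rewrite orbF.
  by rewrite kic ?inE // lac ?inE // !implybT.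
Qed.

(** Dually, an ideal missing [(r, c)] misses the whole listed row [r], which is then removed from
    [E]. *)
Lemma admissible_row la mu r rs c cs E kap : uniq (r :: rs) ->
  (forall j, j \in c :: cs -> (r, j) \notin mu) ->
  admissible la mu (r :: rs) (c :: cs) E kap && ((r, c) \notin kap) =
  admissible la mu rs (c :: cs) (E :\: [set p | (p.1 == r) && (p.2 \in c :: cs)]) kap.
Proof.
move=> /andP[nrs _] mur; apply/idP/idP.
- case/andP=> /and3P[rk ck /forallP ek] kc.
  have kic j : j \in c :: cs -> (r, j) \notin kap.
    rewrite inE => /predU1P[-> //|jcs]; apply: contra kc.
    by have /andP[/andP[/allP/(_ j jcs)/implyP]] := rk.
  apply/and3P; split.
  + by case/andP: rk.
  + by move: ck; apply: sub_all => i /andP[].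
  apply/forallP => -[i j]; have := ek (i, j); rewrite /= !inE.
  have [->|ic] := eqVneq i r; last by [].
  rewrite (negbTE nrs) /=.
  case: ifP => [jR _|_ /eqP -> //].
  by rewrite (negbTE (kic _ _)) ?inE.
- case/and3P=> rk ck /forallP ek.
  have kic j : j \in c :: cs -> (r, j) \notin kap.
    move=> jR; have := ek (r, j); rewrite /= (negbTE nrs) => /eqP ->.
    by rewrite !inE eqxx -in_cons jR.
  rewrite kic ?mem_head // andbT; apply/and3P; split.
  + apply/andP; split=> //; apply: (@sub_in_pairwise _ (mem (c :: cs)) (fun _ _ => true)).
    * by move=> i j _ jR _ /=; rewrite (negbTE (kic _ _)).
    * exact/allP.
    * by elim: (c :: cs) => //= a s ->; rewrite andbT; apply/allP.
  + apply/allP=> i iR /=; rewrite (allP ck) // andbT; apply/allP => j _.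
    by rewrite (negbTE (kic _ _)).
  apply/forallP => -[i j]; have := ek (i, j); rewrite /= [i \in r :: rs]inE.
  have [->|ic] := eqVneq i r; last by rewrite !inE (negbTE ic).
  rewrite (negbTE nrs) /= !inE eqxx /=.
  case: ifP => [jR _|_]; last by [].
  by rewrite (negbTE (kic _ _)) ?inE // (negbTE (mur _ _)) ?inE.
Qed.

(** The sum splits on whether the bottom-left corner lies in [kap]: a full column gives the [x] term
    of the recursion, an empty row the [y] term. *)
Lemma path_polyE x y la mu rs cs E : mu \subset la -> uniq rs -> uniq cs ->
  row_closed rs cs la -> row_closed rs cs mu ->
  col_closed rs cs la -> col_closed rs cs mu ->
  \sum_(kap | admissible la mu rs cs E kap)
     x ^+ cols_in rs cs (kap :\: mu) * y ^+ rows_in rs cs (la :\: kap)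
  = path_poly x y la mu rs cs.
Proof.
move=> /subsetP sub.
elim: rs cs E => [|r rs IHr].
  move=> cs E _ _ _ _ _ _ /=; rewrite (big_pred1 E) => [|k].
    by rewrite /cols_in /rows_in /= (eq_count (a2 := pred0)) // count_pred0 !expr0 mulr1.
  rewrite /admissible andbA; have -> : row_closed [::] cs k && col_closed [::] cs k.
    by rewrite /=; elim: cs => //= c cs ->.
  apply/forallP/eqP => [H|-> p]; last by rewrite eqxx.
  by apply/setP => p; apply/eqP/H.
elim=> [|c cs IHc] E ur uc.
  move=> _ _ _ _; rewrite path_poly_nilr (big_pred1 E) => [|k].
    by rewrite /cols_in /rows_in /= (eq_count (a2 := pred0)) // count_pred0 !expr0 mulr1.
  rewrite /admissible andbA; have -> : row_closed (r :: rs) [::] k && col_closed (r :: rs) [::] k.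
    by rewrite /= andbT; elim: (rs) => //= c cs ->.
  apply/forallP/eqP => [H|-> p]; last by rewrite andbF eqxx.
  by apply/setP => p; apply/eqP; have := H p; rewrite andbF.
move=> rl rm cl cm.
rewrite path_poly_cons.
have lac : (r, c) \in la -> forall i, i \in r :: rs -> (i, c) \in la.
  move=> h i; rewrite inE => /predU1P[-> //|iR].
  by have /andP[/andP[/allP/(_ i iR)/implyP/(_ h)]] := cl.
have muc : (r, c) \in mu -> forall i, i \in r :: rs -> (i, c) \in mu.
  move=> h i; rewrite inE => /predU1P[-> //|iR].
  by have /andP[/andP[/allP/(_ i iR)/implyP/(_ h)]] := cm.
have lar : (r, c) \notin la -> forall j, j \in c :: cs -> (r, j) \notin la.
  move=> h j; rewrite inE => /predU1P[-> //|jR]; apply: contra h.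
  by have /andP[/andP[/allP/(_ j jR)/implyP]] := rl.
have mur : (r, c) \notin mu -> forall j, j \in c :: cs -> (r, j) \notin mu.
  move=> h j; rewrite inE => /predU1P[-> //|jR]; apply: contra h.
  by have /andP[/andP[/allP/(_ j jR)/implyP]] := rm.
(* Column [c] is full in [kap]: it counts in [kap :\: mu] unless [mu] contains it, and it adds no
   row to [la :\: kap]. *)
have Ein : (r, c) \in la ->
   \sum_(kap | admissible la mu (r :: rs) (c :: cs) E kap && ((r, c) \in kap))
     x ^+ cols_in (r :: rs) (c :: cs) (kap :\: mu) * y ^+ rows_in (r :: rs) (c :: cs) (la :\: kap)
   = x ^+ ((r, c) \notin mu) * path_poly x y la mu (r :: rs) cs.
  move=> h; rewrite -(IHc (E :|: [set p | (p.2 == c) && (p.1 \in r :: rs)])) //; first last.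
  - by case/andP: cm.
  - by case/andP: cl.
  - by move: rm; apply: sub_all => i /andP[].
  - by move: rl; apply: sub_all => i /andP[].
  - by case/andP: uc.
  rewrite big_distrr /=; apply: eq_big => [k|k /andP[ak kc]]; first exact: admissible_col (lac h).
  have kic i : i \in r :: rs -> (i, c) \in k.
    case/and3P: ak => _ ck _; rewrite inE => /predU1P[-> //|irs].
    by have /andP[/andP[/allP/(_ i irs)/implyP/(_ kc)]] := ck.
  rewrite mulrA -exprD; congr (_ ^+ _ * _ ^+ _).
    have -> : ((r, c) \notin mu) = has (fun i => (i, c) \in k :\: mu) (r :: rs).
      case: (boolP ((r, c) \in mu)) => m0; last by rewrite /= !inE m0 kc.
      by symmetry; apply/hasPn => i iR; rewrite !inE muc.
    by [].
  suff : rows_in (r :: rs) (c :: cs) (la :\: k) = rows_in (r :: rs) cs (la :\: k) by [].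
  by apply: eq_in_count => i iR; rewrite /= !inE kic.
(* Row [r] is empty in [kap]: it counts in [la :\: kap] exactly when [la] meets it, and it adds no
   column to [kap :\: mu]. *)
have Eout : (r, c) \notin mu ->
   \sum_(kap | admissible la mu (r :: rs) (c :: cs) E kap && ((r, c) \notin kap))
     x ^+ cols_in (r :: rs) (c :: cs) (kap :\: mu) * y ^+ rows_in (r :: rs) (c :: cs) (la :\: kap)
   = y ^+ ((r, c) \in la) * path_poly x y la mu rs (c :: cs).
  move=> h; rewrite -(IHr (c :: cs) (E :\: [set p | (p.1 == r) && (p.2 \in c :: cs)])) //; first last.
  - by move: cm; apply: sub_all => i /andP[].
  - by move: cl; apply: sub_all => i /andP[].
  - by case/andP: rm.
  - by case/andP: rl.
  - by case/andP: ur.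
  rewrite big_distrr /=; apply: eq_big => [k|k /andP[ak kc]]; first exact: admissible_row (mur h).
  have kic j : j \in c :: cs -> (r, j) \notin k.
    case/and3P: ak => rk _ _; rewrite inE => /predU1P[-> //|jR]; apply: contra kc.
    by have /andP[/andP[/allP/(_ j jR)/implyP]] := rk.
  rewrite mulrCA -exprD; congr (_ ^+ _ * _ ^+ _).
    suff : cols_in (r :: rs) (c :: cs) (k :\: mu) = cols_in rs (c :: cs) (k :\: mu) by [].
    by apply: eq_in_count => j jR; rewrite /= !inE (negbTE (kic _ _)) ?andbF.
  have -> : ((r, c) \in la) = has (fun j => (r, j) \in la :\: k) (c :: cs).
    case: (boolP ((r, c) \in la)) => m0; first by rewrite /= !inE m0 kc.
    by symmetry; apply/negbTE/hasPn => j jR; rewrite !inE (negbTE (lar _ _ _)) ?andbF.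
  by [].
(* If the corner lies in [mu] or outside [la], then [kap] has no choice there and one of the two
   sums is empty. *)
have bet k : admissible la mu (r :: rs) (c :: cs) E k ->
    (((r, c) \in mu) ==> ((r, c) \in k)) && (((r, c) \in k) ==> ((r, c) \in la)).
  by case/and3P=> _ _ /forallP/(_ (r, c)); rewrite /= !mem_head.
rewrite (bigID (fun k : {set A * B} => (r, c) \in k)) /=.
case: ifP => [m0|/negbT m0].
  rewrite Ein; last exact: sub.
  rewrite m0 expr0 mul1r big1 ?addr0 // => k /andP[/bet]; rewrite m0 /= => /andP[-> _].
  by [].
rewrite Eout //; case: ifP => [l0|/negbFE l0].
  rewrite (negbTE l0) expr0 mul1r big1 ?add0r // => k /andP[/bet]; rewrite (negbTE l0) implybF.
  by case/andP=> _ /negbTE->.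
by rewrite Ein // l0 m0 !expr1.
Qed.

(** A half turn followed by complementation exchanges [mu] and [la], and turns the recursion at the
    top-right corner into the defining one at the bottom-left corner. *)
Lemma path_poly_rev x y la mu rs cs : mu \subset la ->
  row_closed (rev rs) (rev cs) la -> row_closed (rev rs) (rev cs) mu ->
  col_closed (rev rs) (rev cs) la -> col_closed (rev rs) (rev cs) mu ->
  path_poly x y la mu (rev rs) (rev cs) = path_poly x y (~: mu) (~: la) rs cs.
Proof.
move=> /subsetP sub.
have closed_rows S s t b : row_closed (rcons s b) t S -> row_closed s t S.
  by rewrite /row_closed all_rcons => /andP[].
have closed_rows' S s t b : row_closed s (rcons t b) S -> row_closed s t S.
  by apply: sub_all => ?; rewrite pairwise_rcons => /andP[].
have closed_cols S s t b : col_closed (rcons s b) t S -> col_closed s t S.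
  by apply: sub_all => ?; rewrite pairwise_rcons => /andP[].
have closed_cols' S s t b : col_closed s (rcons t b) S -> col_closed s t S.
  by rewrite /col_closed all_rcons => /andP[].
elim: rs cs => [//|r rs IHr]; elim=> [|c cs IHc]; first by move=> *; apply: path_poly_nilr.
rewrite path_poly_cons !inE negbK => rl rm cl cm.
have E1 : path_poly x y la mu (rev (r :: rs)) (rev cs) = path_poly x y (~: mu) (~: la) (r :: rs) cs.
  by move: rl rm cl cm; rewrite ![rev (c :: cs)]rev_cons => /closed_rows' ? /closed_rows' ? /closed_cols' ? /closed_cols' ?; apply: IHc.
have E2 : path_poly x y la mu (rev rs) (rev (c :: cs)) = path_poly x y (~: mu) (~: la) rs (c :: cs).
  by move: rl rm cl cm; rewrite ![rev (r :: rs)]rev_cons => /closed_rows ? /closed_rows ? /closed_cols ? /closed_cols ?; apply: IHr.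
move: rl rm cl cm; rewrite !rev_cons => rl rm cl cm.
rewrite path_poly_rcons // -!rev_cons E1 E2.
case: (boolP ((r, c) \in mu)) => [/sub -> //|_].
by case: (boolP ((r, c) \in la)).
Qed.
End PathPolynomial.

(** * Sums over the ideals between two ideals *)

Section Ideals.
Variables p q : nat.
Implicit Types (S la mu kap : {set 'I_p * 'I_q}).

Definition ideal S :=
  [forall a : 'I_p * 'I_q, forall b : 'I_p * 'I_q, (a.1 <= b.1)%N && (a.2 <= b.2)%N && (b \in S) ==> (a \in S)].

Lemma idealP S : reflect (forall (i i' : 'I_p) (j j' : 'I_q),
  (i <= i')%N -> (j <= j')%N -> (i', j') \in S -> (i, j) \in S) (ideal S).
Proof.
apply: (iffP idP) => [H i i' j j' ii jj S'|H].
  by have /forallP/(_ (i', j'))/implyP := forallP H (i, j); rewrite /= ii jj; apply.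
by apply/forallP => -[i j]; apply/forallP => -[i' j'] /=; apply/implyP=> /andP[/andP[? ?]]; apply: H.
Qed.

Lemma card_count (T : finType) (P : pred T) : #|[set i | P i]| = count P (enum T).
Proof. by rewrite cardsE cardE enumT -size_filter. Qed.

Definition ncols S := #|[set j | [exists i, (i, j) \in S]]|.
Definition nrows S := #|[set i | [exists j, (i, j) \in S]]|.

Lemma cols_inE S : cols_in (rev (enum 'I_p)) (enum 'I_q) S = ncols S.
Proof.
rewrite /ncols card_count; apply: eq_count => j /=.
rewrite has_rev; apply/hasP/existsP => [[i _ H]|[i H]]; exists i => //.
by rewrite mem_enum.
Qed.

Lemma rows_inE S : rows_in (rev (enum 'I_p)) (enum 'I_q) S = nrows S.
Proof.
rewrite /rows_in count_rev /nrows card_count; apply: eq_count => j /=.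
apply/hasP/existsP => [[i _ H]|[i H]]; exists i => //.
by rewrite mem_enum.
Qed.

Lemma pairwise_enum n (e : rel 'I_n) :
  reflect (forall i j : 'I_n, (i < j)%N -> e i j) (pairwise e (enum 'I_n)).
Proof.
case: n e => [|n] e.
  by rewrite (size0nil (size_enum_ord 0)); apply: ReflectT => i; have := ltn_ord i; rewrite ltn0.
apply: (iffP (pairwiseP ord0)) => [H i j ij|H i j].
  by have := H i j; rewrite !nth_ord_enum; apply=> //; rewrite inE size_enum_ord.
rewrite !inE !size_enum_ord => lti ltj ij.
by apply: H; rewrite !nth_enum_ord.
Qed.

Lemma pairwise_rev (T : Type) (e : rel T) s :
  pairwise e (rev s) = pairwise (fun i j => e j i) s.
Proof. by elim: s => //= i s IH; rewrite rev_cons pairwise_rcons IH all_rev. Qed.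

Lemma pairwise_rev_enum n (e : rel 'I_n) :
  reflect (forall i j : 'I_n, (j < i)%N -> e i j) (pairwise e (rev (enum 'I_n))).
Proof.
rewrite pairwise_rev; by apply: (iffP (pairwise_enum _)) => H i j; apply: H.
Qed.

Lemma ideal_closed S :
  ideal S = row_closed (rev (enum 'I_p)) (enum 'I_q) S
            && col_closed (rev (enum 'I_p)) (enum 'I_q) S.
Proof.
apply/idealP/andP => [H|[/allP rS /allP cS] i i' j j' ii jj].
  split; apply/allP.
    by move=> i _; apply/pairwise_enum => j j' jj; apply/implyP; apply: H => //; apply: ltnW.
  by move=> j _; apply/pairwise_rev_enum => i i' ii; apply/implyP; apply: H => //; apply: ltnW.
move=> S'; have {}S' : (i', j) \in S.
  move: jj; rewrite leq_eqVlt => /predU1P[/val_inj -> //|jj].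
  have /pairwise_enum/(_ _ _ jj)/implyP := rS i' ltac:(by rewrite mem_rev mem_enum).
  exact.
move: ii; rewrite leq_eqVlt => /predU1P[/val_inj -> //|ii].
have /pairwise_rev_enum/(_ _ _ ii)/implyP := cS j ltac:(by rewrite mem_enum).
exact.
Qed.

Lemma idealC_closed S :
  ideal S = row_closed (enum 'I_p) (rev (enum 'I_q)) (~: S)
            && col_closed (enum 'I_p) (rev (enum 'I_q)) (~: S).
Proof.
have implC (a b : bool) : ~~ a ==> ~~ b = (b ==> a) by case: a; case: b.
rewrite ideal_closed /row_closed /col_closed !all_rev; congr andb; apply: eq_all => i.
  by rewrite pairwise_rev; apply: eq_pairwise => j j'; rewrite !inE implC.
by rewrite pairwise_rev; apply: eq_pairwise => j j'; rewrite !inE implC.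
Qed.

Definition between mu la kap := [&& ideal kap, mu \subset kap & kap \subset la].

Lemma admissibleE la mu kap :
  admissible la mu (rev (enum 'I_p)) (enum 'I_q) set0 kap = between mu la kap.
Proof.
rewrite /admissible andbA -ideal_closed; congr andb.
apply/forallP/andP => [H|[/subsetP s1 /subsetP s2] c].
  split; apply/subsetP => c; have := H c; rewrite mem_rev !mem_enum /= => /andP[/implyP h /implyP h'] //.
by rewrite mem_rev !mem_enum /=; apply/andP; split; apply/implyP => ?; [apply: s1|apply: s2].
Qed.

Variable R : comNzRingType.
Implicit Types x y z : R.

Lemma between_sum_path x y la mu : ideal la -> ideal mu -> mu \subset la ->
  \sum_(kap | between mu la kap) x ^+ ncols (kap :\: mu) * y ^+ nrows (la :\: kap)
  = path_poly x y la mu (rev (enum 'I_p)) (enum 'I_q).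
Proof.
rewrite !ideal_closed => /andP[rl cl] /andP[rm cm] sub.
rewrite -(@path_polyE _ _ _ _ _ _ _ _ _ set0) ?rev_uniq ?enum_uniq //.
apply: eq_big => [k|k _]; first by rewrite admissibleE.
by rewrite cols_inE rows_inE.
Qed.

(** Both sums are one path polynomial, read from its two ends. After [path_poly_rev], substituting
    [~: kap] for [kap] exchanges [kap :\: mu] and [la :\: kap]. *)
Lemma between_sum_swap x y la mu : ideal la -> ideal mu ->
  \sum_(kap | between mu la kap) x ^+ ncols (kap :\: mu) * y ^+ nrows (la :\: kap)
  = \sum_(kap | between mu la kap) y ^+ nrows (kap :\: mu) * x ^+ ncols (la :\: kap).
Proof.
move=> il im; case: (boolP (mu \subset la)) => [sub|nsub]; last first.
  have none kap : between mu la kap = false.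
    by apply: contraNF nsub => /and3P[_]; apply: subset_trans.
  by rewrite !big_pred0.
rewrite between_sum_path //; move: (il) (im); rewrite !ideal_closed => /andP[rl cl] /andP[rm cm].
have := @path_poly_rev _ _ R x y la mu (enum 'I_p) (rev (enum 'I_q)) sub.
rewrite revK => /(_ rl rm cl cm) ->.
move: il im; rewrite !idealC_closed => /andP[crl ccl] /andP[crm ccm].
rewrite -(@path_polyE _ _ _ _ _ _ _ _ _ set0) ?rev_uniq ?enum_uniq ?setCS //.
rewrite (reindex_inj (inv_inj (@setCK _))).
apply: eq_big => [kap|k _]; last first.
  rewrite mulrC.
  have -> : ~: k :\: ~: la = la :\: k by apply/setP => c; rewrite !inE negbK andbC.
  have -> : ~: mu :\: ~: k = k :\: mu by apply/setP => c; rewrite !inE negbK andbC.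
  rewrite -cols_inE -rows_inE /cols_in /rows_in !count_rev.
  by congr (_ ^+ _ * _ ^+ _); apply: eq_count => c; rewrite has_rev.
rewrite /admissible /between andbA -idealC_closed; congr andb.
apply/forallP/andP => [H|[/subsetP s1 /subsetP s2] c].
  split; apply/subsetP => c; have := H c; rewrite mem_rev !mem_enum /= !inE !implybE !negbK;
    by case: (c \in kap); case: (c \in la); case: (c \in mu); rewrite //= ?andbF.
rewrite mem_rev !mem_enum /= !inE; apply/andP; split; apply/implyP; apply: contra.
  exact: s2.
exact: s1.
Qed.

Lemma between_sum_total z la mu : ideal la -> ideal mu -> mu \subset la ->
  \sum_(kap | between mu la kap) z ^+ ncols (kap :\: mu) * (1 - z) ^+ nrows (la :\: kap) = 1.
Proof. by move=> *; rewrite between_sum_path ?path_poly_total. Qed.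

End Ideals.

(** * The commuting operators *)

Section Operators.
Variables p q : nat.
Implicit Types (S la mu kap : {set 'I_p * 'I_q}) (s : {set 'I_p * 'I_q} -> nat).

(** The weight is left general: powers of [x] give T(x) and T'(x), while [exponent a] gives their
    coefficients of x^a. *)
Definition skew_op (R : comNzRingType) (w : nat -> R) s (v : {set 'I_p * 'I_q} -> R) mu :=
  \sum_(kap | ideal kap && (mu \subset kap)) w (s (kap :\: mu)) * v kap.

(** The matrix entry at [(mu, la)] of a product of two operators, by [skew_op_comp]. *)
Definition kernel (R : comNzRingType) (w : nat -> R) s (w' : nat -> R) s' mu la :=
  \sum_(kap | between mu la kap) w (s (kap :\: mu)) * w' (s' (la :\: kap)).

Lemma nrows0 : nrows (set0 : {set 'I_p * 'I_q}) = 0%N.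
Proof. by apply: eq_card0 => j; rewrite !inE; apply/existsP => -[i]; rewrite inE. Qed.

Section Ring.
Variable R : comNzRingType.
Implicit Types (w : nat -> R) (v : {set 'I_p * 'I_q} -> R).

Lemma eq_skew_op w s v v' mu :
  (forall kap, ideal kap -> v kap = v' kap) -> skew_op w s v mu = skew_op w s v' mu.
Proof. by move=> vv; apply: eq_bigr => kap /andP[ik _]; rewrite vv. Qed.

Lemma skew_op_comp w s w' s' v mu :
  skew_op w s (skew_op w' s' v) mu =
  \sum_(la | ideal la && (mu \subset la)) kernel w s w' s' mu la * v la.
Proof.
rewrite /skew_op; under eq_bigr do rewrite big_distrr /=.
rewrite (exchange_big_dep (fun la => ideal la && (mu \subset la))) /=; last first.
  by move=> k la /andP[ik mk] /andP[il kl]; rewrite il (subset_trans mk kl).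
apply: eq_bigr => la /andP[il ml]; rewrite /kernel big_distrl /=.
apply: eq_big => [k|k _]; last by rewrite mulrA.
by rewrite /between il -andbA.
Qed.

(** The operator is unitriangular for inclusion, so [v] is recovered by induction from the larger
    ideals down to the smaller ones. *)
Lemma skew_op_inj w s v v' : w 0%N = 1 -> s set0 = 0%N ->
  (forall mu, ideal mu -> skew_op w s v mu = skew_op w s v' mu) ->
  forall mu, ideal mu -> v mu = v' mu.
Proof.
move=> w0 s0 vv mu; have [n] := ubnP #|~: mu|; elim: n mu => // n IH mu lt_n imu.
have := vv mu imu; rewrite /skew_op (bigD1 mu) ?imu //= [in RHS](bigD1 mu) ?imu //=.
rewrite setDv s0 w0 !mul1r; set t := (X in _ + X); set t' := (X in _ = _ + X).
suff -> : t = t' by apply: addIr.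
apply: eq_bigr => k /andP[/andP[ik mk] km]; rewrite IH //.
rewrite -ltnS; apply: leq_trans lt_n; rewrite ltnS proper_card //.
by rewrite properC properEneq eq_sym km.
Qed.

Lemma kernel_col_row x y mu la : ideal mu -> ideal la ->
  kernel (GRing.exp x) (@ncols p q) (GRing.exp y) (@nrows p q) mu la =
  kernel (GRing.exp y) (@nrows p q) (GRing.exp x) (@ncols p q) mu la :> R.
Proof. by move=> im il; apply: between_sum_swap. Qed.

Notation U x := (skew_op (GRing.exp (x : R)) (@ncols p q)).
Notation V x := (skew_op (GRing.exp (x : R)) (@nrows p q)).

Lemma skew_op_col_row x y v mu : ideal mu -> U x (V y v) mu = V y (U x v) mu.
Proof.
move=> im; rewrite !skew_op_comp; apply: eq_bigr => la /andP[il _].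
by rewrite kernel_col_row.
Qed.

(* [V (1 - y)] inverts [U y] up to the zeta operator [V 1] of the inclusion order. *)
Lemma skew_op_row_col_total y v mu : ideal mu -> V (1 - y) (U y v) mu = V 1 v mu.
Proof.
move=> im; rewrite -skew_op_col_row // skew_op_comp; apply: eq_bigr => la /andP[il ml].
by rewrite expr1n /kernel between_sum_total.
Qed.

(** The injective operator [V (1 - y)] sends both sides to [U x (V 1 v)]: it passes [U x] and
    absorbs [U y] on the left, and does so in the other order on the right. *)
Lemma skew_op_col_col x y v mu : ideal mu -> U x (U y v) mu = U y (U x v) mu.
Proof.
move: mu; apply: (@skew_op_inj (GRing.exp (1 - y)) (@nrows p q)); rewrite ?expr0 ?nrows0 // => mu im.
rewrite skew_op_row_col_total // -!skew_op_col_row //.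
by apply: eq_skew_op => k ik; rewrite skew_op_row_col_total.
Qed.

Lemma kernel_col_col x y mu la : ideal mu -> ideal la ->
  kernel (GRing.exp x) (@ncols p q) (GRing.exp y) (@ncols p q) mu la =
  kernel (GRing.exp y) (@ncols p q) (GRing.exp x) (@ncols p q) mu la :> R.
Proof.
move=> im il; case: (boolP (mu \subset la)) => [ml|nml]; last first.
  have none kap : between mu la kap = false.
    by apply: contraNF nml => /and3P[_]; apply: subset_trans.
  by rewrite /kernel !big_pred0.
(* Applied to the indicator of [la], a product of operators returns its matrix entry at
   [(mu, la)]. *)
have := skew_op_col_col x y (fun k => (k == la)%:R) im; rewrite !skew_op_comp.
rewrite (bigD1 la) ?il //= [in X in _ = X](bigD1 la) ?il //= eqxx !mulr1.
rewrite !(big1 _ (fun i => _ && (i != la))) ?addr0 // => k /andP[_ /negbTE->]; exact: mulr0.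
Qed.
End Ring.

(** The coefficient of x^a in x^k. *)
Definition exponent (a k : nat) : int := (k == a)%:R.

(** Taking two independent variables for [x] and [y] turns the identities over an arbitrary ring
    into identities between integer coefficients. *)
Lemma kernel_coef s s' mu la a b :
  (kernel (GRing.exp ('X : {poly {poly int}})) s (GRing.exp ('X%:P)) s' mu la)`_a`_b
  = kernel (exponent a) s (exponent b) s' mu la.
Proof.
rewrite /kernel !coef_sum; apply: eq_bigr => k _.
rewrite -rmorphXn /= coefMC coefXn /exponent [_ == a]eq_sym [_ == b]eq_sym.
by case: eqP => _; rewrite ?mul1r ?mul0r ?coef0 // coefXn.
Qed.

Lemma kernel_coef' s s' mu la a b :
  (kernel (GRing.exp ('X%:P : {poly {poly int}})) s (GRing.exp 'X) s' mu la)`_a`_b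
  = kernel (exponent b) s (exponent a) s' mu la.
Proof.
rewrite /kernel !coef_sum; apply: eq_bigr => k _.
rewrite -rmorphXn /= mulrC coefMC coefXn /exponent [_ == a]eq_sym [_ == b]eq_sym.
by case: eqP => _; rewrite ?mulr1 ?mul1r ?mul0r ?mulr0 ?coef0 // coefXn.
Qed.

Definition row_op a := skew_op (exponent a) (@nrows p q).
Definition col_op a := skew_op (exponent a) (@ncols p q).

Lemma col_row_op a b v mu : ideal mu -> col_op a (row_op b v) mu = row_op b (col_op a v) mu.
Proof.
move=> im; rewrite /col_op /row_op !skew_op_comp; apply: eq_bigr => la /andP[il _].
by rewrite -kernel_coef kernel_col_row // kernel_coef'.
Qed.

Lemma col_col_op a b v mu : ideal mu -> col_op a (col_op b v) mu = col_op b (col_op a v) mu.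
Proof.
move=> im; rewrite /col_op !skew_op_comp; apply: eq_bigr => la /andP[il _].
by rewrite -kernel_coef kernel_col_col // kernel_coef'.
Qed.

Lemma foldr_col_opC a es v mu : ideal mu ->
  col_op a (foldr col_op v es) mu = foldr col_op (col_op a v) es mu.
Proof.
elim: es mu => //= b es IH mu im; rewrite col_col_op //.
by apply: eq_skew_op => k; apply: IH.
Qed.

Lemma foldr_col_row_opC a es v mu : ideal mu ->
  foldr col_op (row_op a v) es mu = row_op a (foldr col_op v es) mu.
Proof.
elim: es mu => //= b es IH mu im; rewrite -col_row_op //.
by apply: eq_skew_op => k; apply: IH.
Qed.

(* The operators commute, so the columns can be traded for rows one factor at a
   time, each time next to [v]. *)
Lemma foldr_col_row v es mu :
  (forall a mu, ideal mu -> col_op a v mu = row_op a v mu) -> ideal mu ->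
  foldr col_op v es mu = foldr row_op v es mu.
Proof.
move=> vE; elim: es mu => //= a es IH mu im.
have eq_foldr v' : (forall k, ideal k -> v' k = row_op a v k) ->
    forall k, ideal k -> foldr col_op v' es k = foldr col_op (row_op a v) es k.
  move=> h; elim: (es) => //= b fs IHf k ik; exact: eq_skew_op.
rewrite foldr_col_opC // (eq_foldr (col_op a v)) ?foldr_col_row_opC //; last exact: vE.
exact: eq_skew_op.
Qed.
End Operators.

(** * Staircases *)

Section Staircase.
Variable n : nat.
Implicit Types mu kap : {set 'I_n * 'I_n}.

(** The box is a parameter because the one attached to [staircase n] has the sides [size] and
    [head], which are only provably equal to [n]. *)
Definition stair p q : {set 'I_p * 'I_q} :=
  [set c : 'I_p * 'I_q | (c.1 + c.2 < n)%N].

(* Each nonempty row or column of [stair \ mu] meets the antidiagonal. *)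
Lemma ncols_stair mu : ideal mu ->
  ncols (stair n n :\: mu) = #|[set j | (rev_ord j, j) \notin mu]|.
Proof.
move=> /idealP im; apply: eq_card => j; rewrite !inE.
apply/existsP/idP => [[i]|H]; last first.
  by exists (rev_ord j); rewrite !inE H /=; have := ltn_ord j; lia.
rewrite !inE /= => /andP[nm lt]; apply: contra nm; apply: im => //=; lia.
Qed.

Lemma nrows_stair mu : ideal mu ->
  nrows (stair n n :\: mu) = #|[set i | (i, rev_ord i) \notin mu]|.
Proof.
move=> /idealP im; apply: eq_card => j; rewrite !inE.
apply/existsP/idP => [[i]|H]; last first.
  by exists (rev_ord j); rewrite !inE H /=; have := ltn_ord j; lia.
rewrite !inE /= => /andP[nm lt]; apply: contra nm; apply: im => //=; lia.
Qed.

Lemma ncols_nrows_stair mu : ideal mu ->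
  ncols (stair n n :\: mu) = nrows (stair n n :\: mu).
Proof.
move=> im; rewrite ncols_stair // nrows_stair // -(card_preimset _ (@rev_ord_inj n)).
by apply: eq_card => i; rewrite !inE rev_ordK.
Qed.

Definition delta_set p q (la mu : {set 'I_p * 'I_q}) : int := (mu == la)%:R.

Definition flip mu : {set 'I_n * 'I_n} :=
  [set c : 'I_n * 'I_n | (c.2, c.1) \in mu].

Lemma flipK : involutive flip.
Proof. by move=> mu; apply/setP => -[i j]; rewrite !inE. Qed.

Lemma ideal_flip mu : ideal (flip mu) = ideal mu.
Proof.
by apply/idealP/idealP => H i i' j j' ii jj; have := H j j' i i' jj ii; rewrite !inE.
Qed.

Lemma foldr_row_flip v es mu : foldr (@row_op n n) v es mu =
  foldr (@col_op n n) (fun kap => v (flip kap)) es (flip mu).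
Proof.
elim: es mu => /= [|a es IH] mu; first by rewrite flipK.
rewrite /row_op /skew_op (reindex_inj (inv_inj flipK)); apply: eq_big => [k|k _].
  rewrite ideal_flip; congr andb; apply/subsetP/subsetP => H -[i j].
    by rewrite inE => /H; rewrite inE.
  by have := H (j, i); rewrite !inE.
rewrite -/(row_op _) IH flipK; congr (exponent _ _ * _).
by apply: eq_card => j; rewrite !inE; apply: eq_existsb => i; rewrite !inE.
Qed.

(** Columns are traded for rows, and [flip] turns rows back into columns while fixing the symmetric
    staircase. *)
Lemma foldr_col_stair_flip es mu : ideal mu ->
  foldr (@col_op n n) (delta_set (stair n n)) es (flip mu) =
  foldr (@col_op n n) (delta_set (stair n n)) es mu.
Proof.
move=> im; rewrite [RHS]foldr_col_row // => [|a k ik].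
  rewrite foldr_row_flip; congr (foldr _ _ _ _); apply/funext => k; congr (nat_of_bool _)%:R.
  rewrite (inv_eq flipK); congr (_ == _).
  by apply/setP => c; rewrite !inE addnC.
(* The delta leaves only the term of the full staircase, where column and row counts agree. *)
rewrite /col_op /row_op /skew_op; apply: eq_bigr => k' _; rewrite /delta_set.
by case: eqP => [->|_]; rewrite ?mulr0 // ncols_nrows_stair.
Qed.
End Staircase.

(** * Reverse plane partitions as chains of ideals *)

Section Count.
Variables (p q N : nat) (La : {set 'I_p * 'I_q}) (m : nat -> nat).
Hypothesis La_ideal : ideal La.
Implicit Types (kap : {set 'I_p * 'I_q}) (Q : {ffun 'I_p * 'I_q -> 'I_N.+1}).

(* [Q] encodes a reverse plane partition of shape [La / kap] with entries in
   ]t, N]; it is 0 off the shape. *)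
Definition extends kap t Q :=
  [&& kap \subset La,
      [forall c, if c \in La :\: kap then (t < Q c)%N else Q c == 0%N :> nat],
      [forall c : 'I_p * 'I_q, forall d : 'I_p * 'I_q,
         [&& c \in La :\: kap, d \in La :\: kap, (c.1 <= d.1)%N & (c.2 <= d.2)%N]
         ==> (Q c <= Q d)%N] &
      [forall i : 'I_N.+1, (t < i)%N ==> (ncols [set c | Q c == i] == m i)]].

Lemma extendsP kap t Q : reflect [/\ kap \subset La,
   forall c, c \in La :\: kap -> (t < Q c)%N,
   forall c, c \notin La :\: kap -> Q c = 0%N :> nat,
   forall c d : 'I_p * 'I_q, c \in La :\: kap -> d \in La :\: kap ->
     (c.1 <= d.1)%N -> (c.2 <= d.2)%N -> (Q c <= Q d)%N &
   forall i : 'I_N.+1, (t < i)%N -> ncols [set c | Q c == i] = m i] (extends kap t Q).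
Proof.
apply: (iffP and4P) => [[s /forallP H1 /forallP H2 /forallP H3]|[s H1 H1' H2 H3]].
  split=> // [c ic|c ic|c d ic id le1 le2|i ti].
  - by have := H1 c; rewrite ic.
  - by have := H1 c; rewrite (negbTE ic) => /eqP.
  - by have /forallP/(_ d)/implyP := H2 c; apply; apply/and4P.
  - by have /implyP/(_ ti)/eqP := H3 i.
split=> //; apply/forallP => c.
- by case: ifPn => [/H1|/H1' ->].
- by apply/forallP => d; apply/implyP => /and4P[]; apply: H2.
- by apply/implyP => /H3 ->.
Qed.

(** Entries would have to exceed [N], so only the empty shape has a filling, namely the zero
    function. *)
Lemma card_extends_last kap : #|[set Q | extends kap N Q]| = (kap == La).
Proof.
case: eqP => [->|neq]; last first.
  apply: eq_card0 => Q; rewrite inE; apply/negP => /extendsP[s H _ _ _].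
  case: neq; apply/eqP; rewrite eqEsubset s /=; apply/subsetP => c cL.
  apply: contraT => ck; have := H c; rewrite inE ck cL => /(_ isT).
  by move=> NQ; have := ltn_ord (Q c); rewrite ltnS leqNgt NQ.
apply/eqP/cards1P; exists [ffun=> ord0]; apply/setP => Q; rewrite !inE.
have E c : c \notin La :\: La by rewrite setDv inE.
apply/extendsP/eqP => [[_ _ H _ _]|->].
  by apply/ffunP => c; apply: val_inj; rewrite /= H // ffunE.
split=> // [c|c _|c d|i Ni]; rewrite ?ffunE // ?(negbTE (E _)) //.
by have := ltn_ord i; rewrite ltnS leqNgt Ni.
Qed.

(** The least possible entry is [t.+1]. By monotonicity its cells together with [kap] form an ideal
    [kap'], and the other entries fill [La :\: kap']. *)
Lemma card_extends_step kap t : ideal kap -> (t < N)%N ->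
  #|[set Q | extends kap t Q]| =
  (\sum_(kap' | ideal kap' && (kap \subset kap'))
     (ncols (kap' :\: kap) == m t.+1) * #|[set Q | extends kap' t.+1 Q]|)%N.
Proof.
move=> /idealP ik tN; have tN1 : (t.+1 < N.+1)%N by [].
pose u : 'I_N.+1 := Ordinal tN1.
pose h Q := kap :|: [set c | Q c == u].
rewrite -sum1_card; under eq_bigl do rewrite inE.
rewrite (partition_big h (fun kap' => ideal kap' && (kap \subset kap'))) => [|Q]; last first.
  case/extendsP=> /subsetP s H1 H0 Hm _; rewrite subsetUl andbT; apply/idealP => i i' j j' ii jj.
  rewrite !inE => /orP[S'|/eqP Qu]; first by rewrite (ik i i' j j').
  case: (boolP ((i, j) \in kap)) => //= nk.
  have in' : (i', j') \in La :\: kap by apply: contraT => /H0; rewrite Qu.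
  have in1 : (i, j) \in La :\: kap.
    move: in'; rewrite !inE nk => /andP[_]; have /idealP := La_ideal; exact.
  apply/eqP/val_inj/eqP; rewrite eqn_leq; apply/andP; split; last exact: H1.
  by have := Hm (i, j) (i', j') in1 in' ii jj; rewrite Qu.
apply: eq_bigr => kap' /andP[/idealP ik' /subsetP kk].
have u0 : (u == ord0) = false by [].
have fiber Q : extends kap t Q -> h Q = kap' ->
    forall c, (c \in kap' :\: kap) = (Q c == u).
  move=> /extendsP[_ _ H0 _ _] <- c; rewrite !inE andb_orr andNb /=.
  case: eqP => [Qu|_]; rewrite ?andbF // andbT.
  by have : c \in La :\: kap by [apply: contraT => /H0; rewrite Qu]; rewrite inE => /andP[].
case: eqP => [wt|nwt]; last first.
  rewrite mul0n big_pred0 // => Q; apply/negP => /andP[eQ /eqP hQ]; apply: nwt.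
  have /extendsP[_ _ _ _ /(_ u) <-//] := eQ.
  by congr ncols; apply/setP => c; rewrite (fiber Q) // inE.
rewrite mul1n -sum1_card; under [RHS]eq_bigl do rewrite inE.
(* On the strip [kap' :\: kap], [f] writes the entry [t.+1] and [g] erases it to the off-shape value
   0. *)
pose f Q : {ffun 'I_p * 'I_q -> 'I_N.+1} := [ffun c => if c \in kap' :\: kap then u else Q c].
pose g Q : {ffun 'I_p * 'I_q -> 'I_N.+1} := [ffun c => if c \in kap' :\: kap then ord0 else Q c].
rewrite (reindex_onto f g) => [|Q /andP[eQ /eqP hQ]]; last first.
  by apply/ffunP => c; rewrite !ffunE (fiber Q) //; case: eqP.
apply: eq_bigl => Q; apply/idP/idP.
- case/andP=> /andP[eQ /eqP hQ] /eqP gf.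
  have Qg c : Q c = if c \in kap' :\: kap then ord0 else f Q c by rewrite -[in LHS]gf ffunE.
  have fb := fiber _ eQ hQ.
  case/extendsP: (eQ) => s H1 H0 Hm Hw.
  have in' c : c \in La :\: kap' -> (c \in La :\: kap) && (c \notin kap' :\: kap).
    rewrite !inE negb_and negbK; case: (boolP (c \in kap')) => //= nk ->.
    by rewrite orbT !andbT; apply: contra nk; apply: kk.
  apply/extendsP; split=> [|c|c|c d|i ti].
  + rewrite -hQ subUset s; apply/subsetP => c; rewrite inE => /eqP fu.
    by have : c \in La :\: kap by [apply: contraT => /H0; rewrite fu]; rewrite inE => /andP[].
  + case/in'/andP => cL ck; rewrite Qg (negbTE ck) ltn_neqAle H1 // andbT.
    by move: ck; rewrite fb; apply: contra => /eqP e; apply/eqP/val_inj.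
  + move=> nc; rewrite Qg; case: ifP => // /negbT ck; apply: H0; move: nc ck; rewrite !inE.
    by case: (c \in kap'); case: (c \in kap); case: (c \in La).
  + move=> /in'/andP[cL ck] /in'/andP[dL dk] le1 le2; rewrite (Qg c) (Qg d) (negbTE ck) (negbTE dk).
    exact: Hm.
  (* Levels above [t.+1] do not see the strip, where the entry is [u] before erasure and 0 after
     it. *)
  + rewrite -Hw; last exact: ltnW.
    congr ncols; apply/setP => c; rewrite !inE Qg fb; case: (f Q c =P u) => // ->.
    by rewrite -[u == i]val_eqE -[ord0 == i]val_eqE /=; case: (val i) ti => // k /ltn_eqF->.
- case/extendsP=> s H1 H0 Hm Hw.
  have Qk c : c \in kap' -> Q c = ord0.
    by move=> ck; apply: val_inj; rewrite /= H0 // inE ck.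
  have Qu c : (f Q c == u) = (c \in kap' :\: kap).
    rewrite ffunE; case: ifP => ck; first by rewrite eqxx.
    apply/negbTE/eqP => Qc; move: (H1 c) (H0 c); rewrite Qc /=.
    by case: (c \in La :\: kap') => [/(_ isT)|_ /(_ isT)] //; rewrite ltnn.
  have sk : kap \subset La by apply: subset_trans s; apply/subsetP.
  apply/andP; split; last first.
    by apply/eqP/ffunP => c; rewrite !ffunE; case: (boolP (c \in kap' :\: kap)) => // ck;
      rewrite Qk //; move: ck; rewrite inE => /andP[].
  apply/andP; split; last first.
    apply/eqP/setP => c; rewrite inE [c \in [set _ | _]]inE Qu !inE.
    by case: (boolP (c \in kap)) => [/kk ->|].
  have split c : c \in La :\: kap -> (c \in kap' :\: kap) || (c \in La :\: kap').
    by rewrite !inE; case: (c \in kap'); case: (c \in kap).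
  apply/extendsP; split=> [//|c|c|c d|i ti].
  + move=> /split; rewrite ffunE; case: ifP => //= _ /H1; exact: ltnW.
  + rewrite ffunE; case: ifPn => [|ck nc].
      by rewrite !inE => /andP[-> /(subsetP s) ->].
    apply: H0; move: nc ck; rewrite !inE.
    by case: (c \in kap) (kk c) => [/(_ isT) ->|] //; case: (c \in kap'); case: (c \in La).
  + move=> /split cL /split dL le1 le2; rewrite !ffunE.
    move: cL dL; case: ifPn => /= [ck _|ck cL]; case: ifPn => /= [dk _|dk dL] //.
    * exact: ltnW (H1 _ dL).
    (* A strip cell weakly southeast of [c] would force [c] into the ideal [kap']. *)
    * case/negP: ck; move: cL dk; rewrite !inE => /andP[nc _] /andP[_ dk'].
      by case/negP: nc; case: c d le1 le2 dk' => i j [i' j']; apply: ik'.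
    * exact: Hm.
  + have [iu|iu] := eqVneq i u.
      rewrite iu -wt; congr ncols; apply/setP => c; by rewrite inE Qu.
    have lti : (t.+1 < i)%N by rewrite ltn_neqAle ti andbT eq_sym; apply: contra iu => /eqP e; apply/eqP/val_inj.
    rewrite -Hw //; congr ncols; apply/setP => c; rewrite !inE ffunE; case: ifP => // ck.
    rewrite Qk; last by move: ck; rewrite inE => /andP[].
    rewrite [u == i]eq_sym (negbTE iu); apply/esym/negbTE/eqP => /(congr1 val) /= e.
    by move: ti; rewrite -e.
Qed.

Lemma card_extends kap t : ideal kap -> (t <= N)%N ->
  #|[set Q | extends kap t Q]|%:R =
  foldr (@col_op p q) (delta_set La) [seq m i | i <- iota t.+1 (N - t)] kap.
Proof.
move=> ik tN; move eqk: (N - t)%N => k; elim: k t kap ik tN eqk => [|k IH] t kap ik tN eqk.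
  have -> : t = N by lia.
  by rewrite card_extends_last.
rewrite card_extends_step //; last by lia.
rewrite /= natr_sum; apply: eq_bigr => kap' /andP[ik' _].
by rewrite natrM IH //; lia.
Qed.
End Count.

From mathcomp Require Import classical_sets fsbigop.
(* Restores the names shadowed by [classical_sets]. *)
From mathcomp Require Import fintype finset.

(** * Coefficients of the series as counts of encoded fillings *)

Section ReversePlanePartitions.
Variables la mu : seq nat.
Hypotheses (la_part : is_part la) (mu_part : is_part mu) (mu_sub : part_sub mu la).

Definition diagram_set p q (nu : seq nat) : {set 'I_p * 'I_q} :=
  [set c : 'I_p * 'I_q | diagram nu (nat_of_ord c.1, nat_of_ord c.2)].

Lemma diagram_set_ideal p q nu : is_part nu -> ideal (diagram_set p q nu).
Proof.
case/andP=> snu _; apply/idealP => i i' j j' ii jj; rewrite !inE /diagram /= => lt.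
have lti' : (i' < size nu)%N by case: (ltnP i' (size nu)) lt => // h; rewrite nth_default.
apply: leq_ltn_trans jj (leq_trans lt _).
have geq_tr : transitive geq by move=> a b c /= ab bc; apply: leq_trans bc ab.
apply: (sorted_leq_nth geq_tr (@leqnn) 0%N snu) => //.
by rewrite unfold_in /= (leq_ltn_trans ii).
Qed.

Local Notation p := (size la).
Local Notation q := (head 0%N la).
Local Notation La := (diagram_set p q la).
Local Notation Mu := (diagram_set p q mu).

Lemma skew_cell (c : 'I_p * 'I_q) :
  (c \in La :\: Mu) = skew_diagram la mu (nat_of_ord c.1, nat_of_ord c.2).
Proof. by rewrite !inE andbC. Qed.

Definition restrict N (Q : {ffun 'I_p * 'I_q -> 'I_N.+1}) : filling la mu :=
  [ffun c => nat_of_ord (Q (val c))].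

Lemma weight_restrict N (Q : {ffun 'I_p * 'I_q -> 'I_N.+1}) (i : 'I_N.+1) :
  (forall c, c \notin La :\: Mu -> Q c = 0%N :> nat) -> (0 < i)%N ->
  weight (restrict Q) i = ncols [set c | Q c == i].
Proof.
move=> Q0 i0; apply: eq_card => j; rewrite !inE; apply/existsP/existsP.
  case=> c /andP[/eqP <-]; rewrite ffunE => Qc; exists (val c).1.
  by rewrite inE /ccol -surjective_pairing.
case=> k; rewrite inE => /eqP Qi.
have kj : (k, j) \in La :\: Mu by apply: contraT => /Q0; rewrite Qi => e; rewrite e in i0.
rewrite skew_cell in kj; exists (Sub (k, j) kj).
by rewrite /ccol ffunE SubK /= Qi !eqxx.
Qed.

(** For [m] without x_0, [restrict] is a bijection from the encodings counted by [card_extends] at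
    [t = 0] onto the reverse plane partitions with monomial [m]. *)
Lemma dual_groth_chains (m : monomial) N : (forall i, (N < i)%N -> m i = 0%N) ->
  dual_groth la mu m =
  if m 0%N == 0%N then foldr (@col_op p q) (delta_set La) [seq m i | i <- iota 1 N] Mu else 0.
Proof.
move=> mN.
(* Entries are positive, so a monomial involving x_0 has coefficient 0. *)
have weight0 (P : filling la mu) : is_rpp P -> weight P 0 = 0%N.
  case=> pos _ _; apply: eq_card0 => j; rewrite inE; apply/existsP => -[c /andP[_ /eqP]].
  by have := pos c; case: (P c).
case: eqP => [m0|m0]; last first.
  rewrite /dual_groth fsbig1 // => P /= rP; rewrite /mono; case: eqP => // Pm.
  by case: m0; rewrite -Pm rpp_monoE weight0.
have := @card_extends p q N La m (diagram_set_ideal _ _ la_part) Mu 0.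
rewrite subn0 => <- //; last exact: diagram_set_ideal.
set S := [set Q | _]; pose r := [seq restrict Q | Q <- enum S].
have restr_inj : {in S &, injective (@restrict N)}.
  move=> Q Q'; rewrite !inE => /extendsP[_ _ Q0 _ _] /extendsP[_ _ Q0' _ _] /ffunP e.
  apply/ffunP => c; apply: val_inj; rewrite /=; case: (boolP (c \in La :\: Mu)) => cS; last by rewrite Q0 ?Q0'.
  have cS' := cS; rewrite skew_cell in cS'.
  by have := e (Sub c cS'); rewrite !ffunE SubK.
have restr_rpp Q : Q \in S -> is_rpp (restrict Q).
  rewrite inE => /extendsP[_ H1 _ Hm _].
  have cellS (c : cell la mu) : val c \in La :\: Mu by rewrite skew_cell (valP c).
  split=> [c|c d|c d]; rewrite !ffunE; first exact: H1.
    by move=> rcd ccd; apply: Hm => //; rewrite -/(crow c) rcd.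
  by move=> ccd rcd; apply: Hm => //; rewrite -/(ccol c) ccd.
have restr_mono Q : Q \in S -> rpp_mono (restrict Q) = m.
  move=> QS; have := QS; rewrite inE => /extendsP[_ _ Q0 _ Hw].
  apply/fsfunP => i; rewrite rpp_monoE; case: (posnP i) => [->|i0].
    by rewrite m0 weight0 //; apply: restr_rpp.
  case: (ltnP N i) => Ni.
    rewrite mN //; apply: eq_card0 => j; rewrite inE; apply/existsP => -[c /andP[_]].
    by rewrite ffunE => /eqP e; have := ltn_ord (Q (val c)); rewrite e ltnS leqNgt Ni.
  have lti : (i < N.+1)%N by [].
  by rewrite -(Hw (Ordinal lti)) // -weight_restrict.
have restr_surj P : is_rpp P -> rpp_mono P = m -> P \in r.
  case=> pos rowP colP Pm.
  have PN c : (P c < N.+1)%N.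
    rewrite ltnS leqNgt; apply/negP => /mN; rewrite -Pm rpp_monoE => /eqP.
    rewrite cards_eq0 => /eqP/setP/(_ (ccol c)); rewrite !inE => /existsP; case.
    by exists c; rewrite !eqxx.
  (* The preimage of [P] is its extension by 0 to the whole box. *)
  pose Q : {ffun 'I_p * 'I_q -> 'I_N.+1} :=
    [ffun c => if insub c is Some d then inord (P d) else ord0].
  have QP d : Q (val d) = P d :> nat by rewrite ffunE valK inordK.
  have RQ : restrict Q = P by apply/ffunP => d; rewrite ffunE QP.
  have Q0 c : c \notin La :\: Mu -> Q c = 0%N :> nat.
    by rewrite skew_cell => nc; rewrite ffunE insubN.
  apply/mapP; exists Q => //; rewrite mem_enum inE.
  apply/extendsP; split=> [|c|//|c d|i i0].
  - by apply/subsetP => c; rewrite !inE /diagram /= => h; apply: leq_trans h (mu_sub _).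
  - by rewrite skew_cell => cS; rewrite -[c](SubK (cell la mu) cS) QP.
  - rewrite !skew_cell => cS dS le1 le2.
    (* Row and column monotonicity are joined at the corner [(c.1, d.2)], which lies in the skew
       shape because [mu] and [la] are ideals. *)
    have eS : skew_diagram la mu (nat_of_ord c.1, nat_of_ord d.2).
      rewrite -(skew_cell (c.1, d.2)) inE; move: cS dS; rewrite -!skew_cell !inE.
      move=> /andP[cM _] /andP[_ dL]; apply/andP; split.
        have /idealP := diagram_set_ideal p q mu_part; move=> H.
        by apply: contra cM => eM; have := H c.1 c.1 c.2 d.2 (leqnn _) le2; rewrite !inE; apply.
      have /idealP := diagram_set_ideal p q la_part; move=> H.
      by have := H c.1 d.1 d.2 d.2 le1 (leqnn _); rewrite !inE; apply.
    have -> : c = val (Sub c cS : cell la mu) by rewrite SubK.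
    have -> : d = val (Sub d dS : cell la mu) by rewrite SubK.
    rewrite !QP; apply: (@leq_trans (P (Sub (c.1, d.2) eS))).
      by apply: rowP; rewrite /crow /ccol !SubK.
    by apply: colP; rewrite /crow /ccol !SubK.
  - by rewrite -weight_restrict // RQ -rpp_monoE Pm.
(* A reverse plane partition outside the list [r] has another monomial and contributes 0, so the sum
   becomes a finite one. *)
transitivity (\sum_(P <- r | `[< is_rpp P >]) mono (rpp_mono P) m).
  rewrite bigfs; first by apply: eq_fsbigl; apply/seteqP; split=> P /= /asboolP.
    by rewrite map_inj_in_uniq ?enum_uniq // => Q Q'; rewrite !mem_enum; apply: restr_inj.
  move=> P /asboolP rP nP; rewrite /mono; case: eqP => // Pm.
  by case/negP: nP; apply: restr_surj.
rewrite big_map big_mkcond /= big_enum -sum1_card natr_sum; apply: eq_bigr => Q QS.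
by rewrite asboolT; [rewrite /mono restr_mono // eqxx | apply: restr_rpp].
Qed.
End ReversePlanePartitions.

(** * Staircase partitions and conjugation symmetry *)

Lemma is_part_staircase n : is_part (staircase n).
Proof.
apply/andP; split.
  apply: (homo_sorted (e := leq)); last exact: iota_sorted.
  by move=> i j ij /=; apply: leq_sub2l.
by apply/mapP => -[i]; rewrite mem_iota /=; lia.
Qed.

Lemma nth_staircase n i : nth 0%N (staircase n) i = (n - i)%N.
Proof.
case: (ltnP i n) => ni; first by rewrite nth_mkseq.
by rewrite nth_default ?size_mkseq //; lia.
Qed.

(** A row [i] that is too long contains the cell [(i, n - i)], whose reflection would be a cell of
    [mu] outside the staircase. *)
Lemma part_sub_conj n mu : is_part mu -> part_sub mu (staircase n) ->
  part_sub (conj_part mu) (staircase n).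
Proof.
move=> pm sub i; rewrite nth_staircase leqNgt; apply/negP => lt.
have := diagram_conj_part i (n - i)%N pm; rewrite /diagram /= lt => /esym lt'.
by have := leq_trans lt' (sub _); rewrite nth_staircase; lia.
Qed.

Theorem theorem1p2 (n : nat) (n_gt0 : (0 < n)%N) (mu : seq nat)
    (mu_part : is_part mu) (mu_sub : part_sub mu (staircase n)) :
  dual_groth (staircase n) mu = dual_groth (staircase n) (conj_part mu).
Proof.
(* The largest variable index in [m], or 0 for an empty support. *)
apply/funext => m; pose N := \max_(i <- finsupp m) i.
have mN i : (N < i)%N -> m i = 0%N.
  move=> Ni; apply: fsfun_dflt; apply: contraL Ni => im; rewrite -leqNgt.
  exact: (leq_bigmax_seq (F := id)).
rewrite !(@dual_groth_chains _ _ _ _ _ m N) ?is_part_staircase ?conj_part_is_part //; last exact: part_sub_conj.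
case: ifP => // _.
(* Both sides of the box occur in types, so they are generalized before being replaced by [n]. *)
have : size (staircase n) = n by rewrite size_mkseq.
have : head 0%N (staircase n) = n by rewrite -nth0 nth_staircase subn0.
have stairE p q : diagram_set p q (staircase n) = stair n p q.
  by apply/setP => c; rewrite !inE /diagram /= nth_staircase ltn_subRL.
rewrite !stairE; move: (size _) (head _ _) => p q -> ->.
have -> : diagram_set n n (conj_part mu) = flip (diagram_set n n mu).
  by apply/setP => c; rewrite !inE diagram_conj_part.
by rewrite foldr_col_stair_flip //; apply: diagram_set_ideal.
Qed.
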